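(* Every polyhedron $P$ in $\mathbb{R}^3$ that can be decomposed into a finite number of regular octahedra and regular tetrahedra can be inside-out dissected.
   Context: A decomposition of $P$ into polyhedra means finitely many polyhedra with pairwise disjoint interiors whose union is $P$. An inside-out dissection of a polyhedron $P$ is a decomposition of $P$ into finitely many polyhedra $P_1,\ldots,P_k$ (called pieces) such that (1) the pieces can be rearranged, applying to each piece only a rotation and a translation, to form a polyhedron $P'$ congruent to $P$, and (2) the boundary of $P'$ is composed of internal cuts of $P$, i.e. of (images of) portions of the pieces' boundaries that lay in the interior of $P$ rather than on the boundary of $P$. $P$ can be inside-out dissected if such a decomposition exists. *)

(* Defs.v *)
From HB Require Import structures.
From mathcomp Require Import all_boot all_order all_algebra.
From mathcomp Require Import all_classical all_reals all_analysis.
Set Implicit Arguments. Unset Strict Implicit. Unset Printing Implicit Defensive.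
Import Order.TTheory GRing.Theory Num.Theory.
Import numFieldNormedType.Exports.
Local Open Scope ring_scope.
Local Open Scope classical_set_scope.

Section Polyhedra.
Variable R : realType.
(* points of R^3 are row vectors; the topology is the product (norm) topology *)
Notation pt := 'rV[R]_3.

Definition dot (u v : pt) : R := \sum_(i < 3) u ord0 i * v ord0 i.
Definition sqdist (u v : pt) : R := dot (u - v) (u - v).

Definition conv (s : seq pt) : set pt :=
  [set x | exists l : 'I_(size s) -> R,
      (forall i, 0 <= l i) /\ \sum_i l i = 1 /\ x = \sum_i l i *: s`_i].

Definition nondeg_tetra (a b c d : pt) : Prop :=
  \det (\matrix_(i < 3, j < 3) ([:: b - a; c - a; d - a]`_i) ord0 j) != 0.

Definition polyhedron (P : set pt) : Prop :=
  exists (n : nat) (a b c d : 'I_n -> pt),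
    (0 < n)%N /\ (forall i, nondeg_tetra (a i) (b i) (c i) (d i)) /\
    P = \bigcup_i conv [:: a i; b i; c i; d i].

Definition decomposition (k : nat) (Pc : 'I_k -> set pt) (P : set pt) : Prop :=
  (forall i j, i != j -> interior (Pc i) `&` interior (Pc j) = set0) /\
  \bigcup_i Pc i = P.

Definition regular_tetrahedron (T : set pt) : Prop :=
  exists (a b c d : pt) (s : R), 0 < s /\
    sqdist a b = s /\ sqdist a c = s /\ sqdist a d = s /\
    sqdist b c = s /\ sqdist b d = s /\ sqdist c d = s /\
    T = conv [:: a; b; c; d].

Definition regular_octahedron (O : set pt) : Prop :=
  exists (c u v w : pt), 0 < dot u u /\ dot v v = dot u u /\ dot w w = dot u u /\
    dot u v = 0 /\ dot u w = 0 /\ dot v w = 0 /\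
    O = conv [:: c + u; c - u; c + v; c - v; c + w; c - w].

Definition orthogonal_mx (Q : 'M[R]_3) : Prop := Q *m Q^T = 1%:M.
Definition rotation_mx (Q : 'M[R]_3) : Prop := orthogonal_mx Q /\ \det Q = 1.

Definition motion (Q : 'M[R]_3) (t : pt) (x : pt) : pt := x *m Q + t.

Definition congruent (A B : set pt) : Prop :=
  exists (Q : 'M[R]_3) (t : pt), orthogonal_mx Q /\ B = motion Q t @` A.

Definition boundary (A : set pt) : set pt := closure A `\` interior A.

Definition inside_out_dissectable (P : set pt) : Prop :=
  exists (k : nat) (Pc : 'I_k -> set pt) (Q : 'I_k -> 'M[R]_3) (t : 'I_k -> pt)
         (P' : set pt),
    (forall i, polyhedron (Pc i)) /\ decomposition Pc P /\
    (forall i, rotation_mx (Q i)) /\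
    decomposition (fun i => motion (Q i) (t i) @` Pc i) P' /\
    congruent P P' /\
    boundary P' `<=`
      closure (\bigcup_i motion (Q i) (t i) @` (boundary (Pc i) `&` interior P)).

End Polyhedra.

(* Main.v *)
Require Import Defs.
From HB Require Import structures.
From mathcomp Require Import all_boot all_order all_algebra.
From mathcomp Require Import all_classical all_reals all_analysis.
From mathcomp Require Import ring lra.
Import Order.TTheory GRing.Theory Num.Theory.
Import numFieldNormedType.Exports.
Local Open Scope ring_scope.
Local Open Scope classical_set_scope.

(* Every nondegenerate tetrahedron can be turned inside out onto itself using
   translations only.  With barycentric coordinates scaled to have sum 5, the
   planes on which a coordinate is an integer cut it into cells
   b_j <= x_j <= b_j + 1 with b in N^4, where b has sum 4 (small copies of the
   tetrahedron), 3 (octahedra) or 2 (reflected copies).  Cells with equal sums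
   are translates of each other, and facets on the boundary belong to cells with
   some b_j = 0 and sum 3 or 4.  There is a permutation of the indices
   preserving sums under which b and its image never vanish at the same
   coordinate (for sums 3 and 4), so every exposed facet of a moved cell was an
   internal cut.  A regular octahedron splits into four tetrahedra around a
   diagonal, and doing this inside each tetrahedron of a decomposition of P
   dissects P, because the boundary of P is covered by those of the cells. *)

Section Dissection.
Context {R : realType}.
Notation pt := 'rV[R]_3.

(** * Determinants, dot products and convex hulls in coordinates *)

Definition det3 (x y z : pt) : R :=
  let X i := x ord0 i in let Y i := y ord0 i in let Z i := z ord0 i in
  let i0 := ord0 : 'I_3 in let i1 := lift ord0 ord0 : 'I_3 in
  let i2 := lift ord0 (lift ord0 ord0) : 'I_3 in
  X i0 * (Y i1 * Z i2 - Y i2 * Z i1) - X i1 * (Y i0 * Z i2 - Y i2 * Z i0)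
  + X i2 * (Y i0 * Z i1 - Y i1 * Z i0).

Lemma nondeg_tetraE (a b c d : pt) :
  nondeg_tetra a b c d <-> det3 (b - a) (c - a) (d - a) != 0.
Proof.
rewrite /nondeg_tetra.
suff -> : \det (\matrix_(i < 3, j < 3) ([:: b - a; c - a; d - a]`_i) ord0 j)
   = det3 (b - a) (c - a) (d - a) by [].
rewrite (expand_det_row _ ord0) !big_ord_recl big_ord0 /cofactor.
rewrite !(expand_det_row _ ord0) !big_ord_recl !big_ord0 /cofactor !det_mx11.
rewrite /det3 !mxE /= /bump /=.
have e1 : lift (lift ord0 ord0) ord0 = ord0 :> 'I_3 by apply/val_inj.
have e2 : lift (lift ord0 (lift ord0 ord0)) ord0 = ord0 :> 'I_3 by apply/val_inj.
have e3 : lift (lift ord0 ord0) (lift ord0 ord0) = lift ord0 (lift ord0 ord0) :> 'I_3 by apply/val_inj.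
have e4 : lift (lift ord0 (lift ord0 ord0)) (lift ord0 ord0) = lift ord0 ord0 :> 'I_3 by apply/val_inj.
have e5 : lift (lift ord0 ord0) ord0 = ord0 :> 'I_2 by apply/val_inj.
rewrite ?e5 ?e1 ?e2 ?e3 ?e4 /= ?add0n ?addn0.
rewrite !expr0 !expr1 (_ : (-1) ^+ (1 + 1) = 1 :> R); last by ring.
ring.
Qed.

Lemma dotE (x y : pt) : dot x y = x ord0 ord0 * y ord0 ord0
  + x ord0 (lift ord0 ord0) * y ord0 (lift ord0 ord0)
  + x ord0 (lift ord0 (lift ord0 ord0)) * y ord0 (lift ord0 (lift ord0 ord0)).
Proof. by rewrite /dot !big_ord_recl big_ord0 addr0 addrA. Qed.

(** The right side is the Gram determinant, so nondegeneracy of a tetrahedron can be read off from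
    lengths and angles alone. *)
Lemma det3_gram (x y z : pt) : det3 x y z ^+ 2 =
  dot x x * (dot y y * dot z z - dot y z ^+ 2)
  - dot x y * (dot x y * dot z z - dot y z * dot x z)
  + dot x z * (dot x y * dot y z - dot y y * dot x z).
Proof. rewrite !dotE /det3; ring. Qed.

Lemma conv4P (a b c d x : pt) : Defs.conv [:: a; b; c; d] x <->
  exists l0 l1 l2 l3 : R, [/\ 0 <= l0, 0 <= l1, 0 <= l2 & 0 <= l3] /\
    l0 + l1 + l2 + l3 = 1 /\ x = l0 *: a + l1 *: b + l2 *: c + l3 *: d.
Proof.
split=> [[l [l0 [l1 ->]]]|[l0 [l1 [l2 [l3 [[h0 h1 h2 h3] [hs ->]]]]]]].
  exists (l ord0), (l (lift ord0 ord0)), (l (lift ord0 (lift ord0 ord0))),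
    (l (lift ord0 (lift ord0 (lift ord0 ord0)))).
  move: l1; rewrite !big_ord_recl !big_ord0 /= !addr0 !addrA => ->.
  by split.
exists (fun i => [:: l0; l1; l2; l3]`_i); split; first by case; do 4!case=> //.
by rewrite !big_ord_recl !big_ord0 /= !addr0 !addrA.
Qed.

Lemma conv6P (a b c d e f x : pt) : Defs.conv [:: a; b; c; d; e; f] x <->
  exists l0 l1 l2 l3 l4 l5 : R,
    [/\ 0 <= l0, 0 <= l1 & 0 <= l2] /\ [/\ 0 <= l3, 0 <= l4 & 0 <= l5] /\
    l0 + l1 + l2 + l3 + l4 + l5 = 1 /\
    x = l0 *: a + l1 *: b + l2 *: c + l3 *: d + l4 *: e + l5 *: f.
Proof.
split=> [[l [l0 [l1 ->]]]|
  [l0 [l1 [l2 [l3 [l4 [l5 [[h0 h1 h2] [[h3 h4 h5] [hs ->]]]]]]]]]].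
  exists (l ord0), (l (lift ord0 ord0)), (l (lift ord0 (lift ord0 ord0))),
    (l (lift ord0 (lift ord0 (lift ord0 ord0)))),
    (l (lift ord0 (lift ord0 (lift ord0 (lift ord0 ord0))))),
    (l (lift ord0 (lift ord0 (lift ord0 (lift ord0 (lift ord0 ord0)))))).
  move: l1; rewrite !big_ord_recl !big_ord0 /= !addr0 !addrA => ->.
  by split.
exists (fun i => [:: l0; l1; l2; l3; l4; l5]`_i); split; first by case; do 6!case=> //.
by rewrite !big_ord_recl !big_ord0 /= !addr0 !addrA.
Qed.

(** * Neighbourhoods along segments, and barycentric coordinates *)

Lemma nbhs_segment (p w : pt) (A : set pt) : nbhs p A ->
  exists e : R, [/\ 0 < e, e <= 1 & A (p + e *: w)].
Proof.
move=> pA.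
have h : (fun e : R => p + e *: w) @ (0 : R) --> p + 0 *: w.
  by apply: cvgD; [exact: cvg_cst|apply: cvgZr_tmp; exact: cvg_id].
rewrite scale0r addr0 in h.
have := h A pA; rewrite /= => /nbhs_ballP[e /= e0 he].
have m0 : 0 < Num.min (e / 2) 1 by rewrite lt_min ltr01 divr_gt0.
exists (Num.min (e / 2) 1); split=> //; first by rewrite ge_min lexx orbT.
apply: he; rewrite /ball /= sub0r normrN gtr0_norm// gt_min.
by rewrite ltr_pdivrMr// ltr_pMr// ltr1n.
Qed.

(** The last clause encodes affine independence of the vertices [V]: an affine combination
    determines its coefficients. *)
Definition barycentric (V : 'I_4 -> pt) (L : 'I_4 -> pt -> R) :=
  [/\ forall j, continuous (L j), forall p, \sum_j L j p = 1,
      forall p, p = \sum_j L j p *: V j &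
      forall l, \sum_j l j = 1 -> forall j, L j (\sum_k l k *: V k) = l j].

(** Multiplying [p - a] by the inverse of the edge matrix gives the coordinates at [b], [c], [d];
    the one at [a] is what is missing to 1. *)
Lemma barycentric_exists (a b c d : pt) : nondeg_tetra a b c d ->
  exists L, barycentric (fun j => [:: a; b; c; d]`_j) L.
Proof.
rewrite /nondeg_tetra; set M := \matrix_(i, j) _ => M0.
have Mu : M \in unitmx by rewrite unitmxE unitfE.
pose y p : 'rV[R]_3 := (p - a) *m invmx M.
have mulM (u : 'rV[R]_3) : u *m M = u ord0 ord0 *: (b - a)
    + u ord0 (lift ord0 ord0) *: (c - a)
    + u ord0 (lift ord0 (lift ord0 ord0)) *: (d - a).
  rewrite mulmx_sum_row !big_ord_recl big_ord0 addr0 addrA.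
  by congr (_ *: _ + _ *: _ + _ *: _); apply/rowP => i; rewrite !mxE.
have yM p : y p *m M = p - a by rewrite /y mulmxKV.
have ycont (j : 'I_3) : continuous (fun p => y p ord0 j).
  have -> : (fun p => y p ord0 j) =
      fun p => \sum_(i < 3) (p ord0 i - a ord0 i) * invmx M i j.
    by apply/funext => p; rewrite mxE; apply: eq_bigr => i _; rewrite !mxE.
  have h (i : 'I_3) : continuous (fun p : pt => (p ord0 i - a ord0 i) * invmx M i j).
    move=> p; apply: (@cvgMr_tmp R pt (nbhs p) _ (fun q : pt => q ord0 i - a ord0 i)).
    by apply: cvgB; [exact: coord_continuous|exact: cvg_cst].
  under [X in continuous X]eq_fun do rewrite !big_ord_recl big_ord0 addr0.
  by move=> p; exact: cvgD (h _ p) (cvgD (h _ p) (h _ p)).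
pose L (j : 'I_4) (p : pt) : R := [:: 1 - y p ord0 ord0 - y p ord0 (lift ord0 ord0)
   - y p ord0 (lift ord0 (lift ord0 ord0)); y p ord0 ord0; y p ord0 (lift ord0 ord0);
   y p ord0 (lift ord0 (lift ord0 ord0))]`_j.
exists L; split.
- case; case=> [|[|[|[|//]]]] /= i; rewrite /L /=; try exact: ycont.
  move=> p; exact: cvgB (cvgB (cvgB (cvg_cst _) (ycont _ p)) (ycont _ p)) (ycont _ p).
- by move=> p; rewrite !big_ord_recl big_ord0 /L /=; ring.
- move=> p; rewrite !big_ord_recl big_ord0 /L /=.
  have := yM p; rewrite mulM => h.
  apply: (addIr (- a)); rewrite -h; apply/rowP => i; rewrite !mxE; ring.
- move=> l; rewrite !big_ord_recl !big_ord0 /= => hl.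
  have hy : y (l ord0 *: a + (l (lift ord0 ord0) *: b + (l (lift ord0 (lift ord0 ord0)) *: c
    + (l (lift ord0 (lift ord0 (lift ord0 ord0))) *: d + 0))))
    = \row_(i < 3) l (lift ord0 i).
    apply: (can_inj (mulmxK Mu)); rewrite yM mulM; apply/rowP => i; rewrite !mxE.
    have -> : l ord0 = 1 - l (lift ord0 ord0) - l (lift ord0 (lift ord0 ord0))
      - l (lift ord0 (lift ord0 (lift ord0 ord0))) by rewrite -hl; ring.
    ring.
  case; case=> [|[|[|[|//]]]] /= i; rewrite /L hy !mxE /=.
  + by rewrite (_ : Ordinal i = ord0); [rewrite -hl; ring|exact/val_inj].
  + by congr l; apply/val_inj.
  + by congr l; apply/val_inj.
  + by congr l; apply/val_inj.
Qed.

(** * Polyhedra and the three cell shapes *)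

Lemma polyhedron_tetra (a b c d : pt) :
  nondeg_tetra a b c d -> polyhedron (Defs.conv [:: a; b; c; d]).
Proof.
move=> nd; exists 1%N, (fun=> a), (fun=> b), (fun=> c), (fun=> d).
by split=> //; split=> //; rewrite bigcup_const//; exists ord0.
Qed.

Lemma polyhedronU (A B : set pt) :
  polyhedron A -> polyhedron B -> polyhedron (A `|` B).
Proof.
move=> [m [a [b [c [d [m0 [nd ->]]]]]]] [n [a' [b' [c' [d' [n0 [nd' ->]]]]]]].
pose glue (f : 'I_m -> pt) (g : 'I_n -> pt) (i : 'I_(m + n)) :=
  match fintype.split i with inl j => f j | inr j => g j end.
exists (m + n)%N, (glue a a'), (glue b b'), (glue c c'), (glue d d').
split; first by rewrite addn_gt0 m0.
split; first by move=> i; rewrite /glue; case: splitP.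
apply/seteqP; split=> [x [[i _]|[i _]] h|x [i _]].
- by exists (lshift n i) => //; rewrite /glue (unsplitK (inl _ i)).
- by exists (rshift m i) => //; rewrite /glue (unsplitK (inr _ i)).
- by rewrite /glue; case: splitP => j _ h; [left|right]; exists j.
Qed.

(** Affine image of the slice of the unit 4-cube with coordinate sum [m]: a tetrahedron for 1, an
    octahedron for 2, a reflected tetrahedron for 3. *)
Definition hypersimplex (m : R) (B U0 U1 U2 U3 : pt) : set pt :=
  [set p | exists f0 f1 f2 f3 : R,
    [/\ 0 <= f0 <= 1, 0 <= f1 <= 1, 0 <= f2 <= 1 & 0 <= f3 <= 1] /\
    f0 + f1 + f2 + f3 = m /\
    p = B + (f0 *: U0 + f1 *: U1 + f2 *: U2 + f3 *: U3)].

Lemma polyhedron_hypersimplex1 (B U0 U1 U2 U3 : pt) :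
  nondeg_tetra U0 U1 U2 U3 -> polyhedron (hypersimplex 1 B U0 U1 U2 U3).
Proof.
move=> nd.
suff -> : hypersimplex 1 B U0 U1 U2 U3 =
    Defs.conv [:: B + U0; B + U1; B + U2; B + U3].
  apply/polyhedron_tetra/nondeg_tetraE; move/nondeg_tetraE: nd.
  by congr (det3 _ _ _ != 0); apply/rowP => i; rewrite !mxE; ring.
apply/seteqP; split=> p.
  move=> [f0 [f1 [f2 [f3 [[h0 h1 h2 h3] [hs ->]]]]]]; apply/conv4P.
  exists f0, f1, f2, f3; split; first by split; lra.
  split=> //; have -> : f0 = 1 - f1 - f2 - f3 by lra.
  by apply/rowP => i; rewrite !mxE; ring.
move=> /conv4P[f0 [f1 [f2 [f3 [[h0 h1 h2 h3] [hs ->]]]]]].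
exists f0, f1, f2, f3; split; first by split; lra.
split=> //; have -> : f0 = 1 - f1 - f2 - f3 by lra.
by apply/rowP => i; rewrite !mxE; ring.
Qed.

(** Replacing each [f] by [1 - f] turns sum 3 into sum 1; this is a point reflection, so the
    determinant only changes sign. *)
Lemma polyhedron_hypersimplex3 (B U0 U1 U2 U3 : pt) :
  nondeg_tetra U0 U1 U2 U3 -> polyhedron (hypersimplex 3 B U0 U1 U2 U3).
Proof.
move=> nd.
suff -> : hypersimplex 3 B U0 U1 U2 U3 =
    Defs.conv [:: B + U1 + U2 + U3; B + U0 + U2 + U3;
                  B + U0 + U1 + U3; B + U0 + U1 + U2].
  apply/polyhedron_tetra/nondeg_tetraE; move/nondeg_tetraE: nd.
  apply: contra_neq; rewrite /det3 !mxE => h.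
  by apply/eqP; rewrite -oppr_eq0 -[X in _ == X]h; apply/eqP; ring.
apply/seteqP; split=> p.
  move=> [f0 [f1 [f2 [f3 [[h0 h1 h2 h3] [hs ->]]]]]]; apply/conv4P.
  exists (1 - f0), (1 - f1), (1 - f2), (1 - f3); split; first by split; lra.
  split; first by lra.
  have -> : f0 = 3 - f1 - f2 - f3 by lra.
  by apply/rowP => i; rewrite !mxE; ring.
move=> /conv4P[f0 [f1 [f2 [f3 [[h0 h1 h2 h3] [hs ->]]]]]].
exists (1 - f0), (1 - f1), (1 - f2), (1 - f3); split; first by split; lra.
split; first by lra.
have -> : f0 = 1 - f1 - f2 - f3 by lra.
by apply/rowP => i; rewrite !mxE; ring.
Qed.

(* One of the four tetrahedra around the diagonal from [B + U0 + U1] to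
   [B + U2 + U3] of the octahedron [hypersimplex 2 B U0 U1 U2 U3]. *)
Definition octa_quarter (B U0 U1 U2 U3 : pt) : set pt :=
  Defs.conv [:: B + U0 + U1; B + U2 + U3; B + U0 + U2; B + U0 + U3].

Lemma octa_quarterP (B U0 U1 U2 U3 p : pt) :
  octa_quarter B U0 U1 U2 U3 p <->
  exists f0 f1 f2 f3 : R,
    [/\ 0 <= f0 <= 1, 0 <= f1 <= 1, 0 <= f2 <= 1 & 0 <= f3 <= 1] /\
    f0 + f1 + f2 + f3 = 2 /\ 1 <= f0 + f2 /\ 1 <= f0 + f3 /\
    p = B + (f0 *: U0 + f1 *: U1 + f2 *: U2 + f3 *: U3).
Proof.
split.
  move=> /conv4P[l0 [l1 [l2 [l3 [[h0 h1 h2 h3] [hs ->]]]]]].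
  exists (l0 + l2 + l3), l0, (l1 + l2), (l1 + l3).
  split; first by split; lra.
  split; first by lra.
  split; first by lra.
  split; first by lra.
  have -> : l0 = 1 - l1 - l2 - l3 by lra.
  by apply/rowP => i; rewrite !mxE; ring.
move=> [f0 [f1 [f2 [f3 [[h0 h1 h2 h3] [hs [h4 [h5 ->]]]]]]]]; apply/conv4P.
(* The planes [f0 + f2 = 1] and [f0 + f3 = 1] contain the diagonal, and the last two weights measure
   how far the point is from them. *)
exists f1, (1 - f0), (f2 + f0 - 1), (f3 + f0 - 1); split; first by split; lra.
split; first by lra.
have -> : f0 = 2 - f1 - f2 - f3 by lra.
by apply/rowP => i; rewrite !mxE; ring.
Qed.

Lemma polyhedron_octa_quarter (B U0 U1 U2 U3 : pt) :
  nondeg_tetra U0 U1 U2 U3 -> polyhedron (octa_quarter B U0 U1 U2 U3).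
Proof.
move=> /nondeg_tetraE nd; apply/polyhedron_tetra/nondeg_tetraE.
move: nd; apply: contra_neq => <-; rewrite /det3 !mxE; ring.
Qed.

(** Comparing [f0 + f2] and [f0 + f3] with 1 selects one of four quarters. As the sum is 2, each
    reversed inequality is the defining one of a quarter with permuted indices, and permuting
    vertices changes the determinant at most by a sign. *)
Lemma polyhedron_hypersimplex2 (B U0 U1 U2 U3 : pt) :
  nondeg_tetra U0 U1 U2 U3 -> polyhedron (hypersimplex 2 B U0 U1 U2 U3).
Proof.
move=> nd.
have perm V0 V1 V2 V3 : det3 (V1 - V0) (V2 - V0) (V3 - V0)
      = det3 (U1 - U0) (U2 - U0) (U3 - U0) \/
    det3 (V1 - V0) (V2 - V0) (V3 - V0)
      = - det3 (U1 - U0) (U2 - U0) (U3 - U0) ->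
    polyhedron (octa_quarter B V0 V1 V2 V3).
  move=> h; apply/polyhedron_octa_quarter/nondeg_tetraE.
  by move/nondeg_tetraE: nd; case: h => ->; rewrite ?oppr_eq0.
suff -> : hypersimplex 2 B U0 U1 U2 U3 =
    (octa_quarter B U0 U1 U2 U3 `|` octa_quarter B U1 U0 U2 U3) `|`
    (octa_quarter B U2 U3 U0 U1 `|` octa_quarter B U3 U2 U0 U1).
  apply: polyhedronU; apply: polyhedronU; apply: perm; rewrite /det3 !mxE.
  - by left.
  - by right; ring.
  - by left; ring.
  - by right; ring.
apply/seteqP; split=> p.
  move=> [f0 [f1 [f2 [f3 [[h0 h1 h2 h3] [hs ->]]]]]].
  have [h02|h02] := lerP 1 (f0 + f2); have [h03|h03] := lerP 1 (f0 + f3).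
  - left; left; apply/octa_quarterP; exists f0, f1, f2, f3.
    by do ![split=> //]; lra.
  - right; left; apply/octa_quarterP; exists f2, f3, f0, f1.
    do 3!(split; first by (split; lra) || lra); split; first lra.
    by congr (_ + _); apply/rowP => i; rewrite !mxE; ring.
  - right; right; apply/octa_quarterP; exists f3, f2, f0, f1.
    do 3!(split; first by (split; lra) || lra); split; first lra.
    by congr (_ + _); apply/rowP => i; rewrite !mxE; ring.
  - left; right; apply/octa_quarterP; exists f1, f0, f2, f3.
    do 3!(split; first by (split; lra) || lra); split; first lra.
    by congr (_ + _); apply/rowP => i; rewrite !mxE; ring.
move=> [[]|[]] /octa_quarterP[f0 [f1 [f2 [f3 [[h0 h1 h2 h3] [hs [_ [_ ->]]]]]]]].
- by exists f0, f1, f2, f3.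
- exists f1, f0, f2, f3; split=> //; split; first lra.
  by congr (_ + _); apply/rowP => i; rewrite !mxE; ring.
- exists f2, f3, f0, f1; split=> //; split; first lra.
  by congr (_ + _); apply/rowP => i; rewrite !mxE; ring.
- exists f2, f3, f1, f0; split=> //; split; first lra.
  by congr (_ + _); apply/rowP => i; rewrite !mxE; ring.
Qed.

(* The cell of index [c.1] is translated onto the cell of index [c.2].  Entries
   with sum 4 index small copies of the tetrahedron, with sum 3 octahedra, with
   sum 2 point reflections of the small copies; the latter have no facet on the
   boundary and stay in place.  The listed pairs are representatives under
   cyclic shifts of the coordinates, except for those with a shorter orbit. *)
Definition moves : seq (seq nat * seq nat) :=
  [seq (rot n c.1, rot n c.2) | n <- iota 0 4, c <-
    [:: ([:: 4; 0; 0; 0], [:: 0; 1; 2; 1]); ([:: 0; 1; 2; 1], [:: 4; 0; 0; 0]);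
        ([:: 3; 1; 0; 0], [:: 0; 0; 3; 1]); ([:: 3; 0; 1; 0], [:: 0; 1; 0; 3]);
        ([:: 3; 0; 0; 1], [:: 0; 1; 3; 0]); ([:: 2; 2; 0; 0], [:: 0; 0; 2; 2]);
        ([:: 0; 1; 1; 2], [:: 1; 1; 2; 0]); ([:: 0; 2; 1; 1], [:: 2; 1; 1; 0]);
        ([:: 3; 0; 0; 0], [:: 0; 1; 1; 1]); ([:: 0; 1; 1; 1], [:: 3; 0; 0; 0]);
        ([:: 2; 1; 0; 0], [:: 0; 0; 2; 1]); ([:: 2; 0; 1; 0], [:: 0; 1; 0; 2]);
        ([:: 2; 0; 0; 1], [:: 0; 1; 2; 0]);
        ([:: 2; 0; 0; 0], [:: 2; 0; 0; 0]); ([:: 1; 1; 0; 0], [:: 1; 1; 0; 0])]]%N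
  ++ [:: ([:: 2; 0; 2; 0], [:: 0; 2; 0; 2]); ([:: 0; 2; 0; 2], [:: 2; 0; 2; 0]);
         ([:: 1; 1; 1; 1], [:: 1; 1; 1; 1]); ([:: 1; 0; 1; 0], [:: 1; 0; 1; 0]);
         ([:: 0; 1; 0; 1], [:: 0; 1; 0; 1])]%N.

(** * Finite checks on the permutation of cells, and covering by cells *)

Definition cell_index (b : seq nat) := (size b == 4) && (2 <= sumn b <= 4)%N.

Lemma moves_uniq : uniq (unzip1 moves) /\ uniq (unzip2 moves).
Proof. by split; vm_compute. Qed.

(** Entries of an index are at most 4, so completeness of a list is a computation over 5^4 tuples.
    Applied to both columns of [moves], and combined with [moves_uniq], it makes [moves] the graph
    of a permutation of all cell indices. *)
Lemma cell_index_complete (s : seq (seq nat)) :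
  all (fun a => all (fun b => all (fun c => all (fun d =>
    (2 <= a + (b + (c + d)) <= 4)%N ==> ([:: a; b; c; d] \in s))
  (iota 0 5)) (iota 0 5)) (iota 0 5)) (iota 0 5) ->
  all cell_index s -> forall b, (b \in s) = cell_index b.
Proof.
move=> hs hi b; apply/idP/idP => [/(allP hi)//|].
case: b => [|a [|b [|c [|d []]]]] // /andP[_ /=]; rewrite addn0 => h.
have small k : (k <= 4)%N -> k \in iota 0 5 by rewrite mem_iota.
have /andP[_ hsum] := h.
have ha : a \in iota 0 5 by apply/small/(leq_trans _ hsum)/leq_addr.
have hb : b \in iota 0 5.
  by apply/small/(leq_trans _ hsum)/(leq_trans _ (leq_addl _ _))/leq_addr.
have hc : c \in iota 0 5.
  apply/small/(leq_trans _ hsum)/(leq_trans _ (leq_addl _ _)).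
  by apply/(leq_trans _ (leq_addl _ _))/leq_addr.
have hd : d \in iota 0 5.
  apply/small/(leq_trans _ hsum)/(leq_trans _ (leq_addl _ _)).
  by apply/(leq_trans _ (leq_addl _ _))/leq_addl.
by have /implyP := allP (allP (allP (allP hs _ ha) _ hb) _ hc) _ hd; apply.
Qed.

Lemma mem_moves1 b : (b \in unzip1 moves) = cell_index b.
Proof. by apply: cell_index_complete; vm_compute. Qed.

Lemma mem_moves2 b : (b \in unzip2 moves) = cell_index b.
Proof. by apply: cell_index_complete; vm_compute. Qed.

Lemma moves_sumn c : c \in moves -> sumn c.1 = sumn c.2.
Proof.
by move=> hc; apply/eqP; move: c hc; apply/allP; vm_compute.
Qed.

(** This is the inside-out property: a zero entry of the target marks a facet that ends on the
    boundary, and a positive entry of the source says that this facet was a cut before. *)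
Lemma moves_exposed c j : c \in moves -> (3 <= sumn c.2)%N -> (j < 4)%N ->
  nth 0%N c.2 j = 0%N -> (0 < nth 0%N c.1 j)%N.
Proof.
move=> hc; have : all (fun c => (3 <= sumn c.2)%N ==>
    all (fun j => (nth 0%N c.2 j == 0%N) ==> (0 < nth 0%N c.1 j)%N) (iota 0 4)) moves.
  by vm_compute.
move=> /allP/(_ _ hc)/implyP h /h /allP {}h j4 /eqP.
by apply/implyP/h; rewrite mem_iota.
Qed.

(** The integer parts of the coordinates have sum more than 5 - 4 = 1 and at most 5. A vanishing
    coordinate leaves only three fractional parts, so the sum then exceeds 5 - 3 = 2. *)
Lemma cell_index_cover (x0 x1 x2 x3 : R) :
  0 <= x0 -> 0 <= x1 -> 0 <= x2 -> 0 <= x3 -> x0 + x1 + x2 + x3 = 5 ->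
  exists b0 b1 b2 b3 : nat, cell_index [:: b0; b1; b2; b3] /\
    [/\ b0%:R <= x0 <= b0.+1%:R, b1%:R <= x1 <= b1.+1%:R,
        b2%:R <= x2 <= b2.+1%:R & b3%:R <= x3 <= b3.+1%:R] /\
    ([\/ x0 = 0, x1 = 0, x2 = 0 | x3 = 0] -> (3 <= b0 + b1 + b2 + b3)%N).
Proof.
move=> h0 h1 h2 h3 hs.
have /andP[l0 u0] := truncn_itv h0; have /andP[l1 u1] := truncn_itv h1.
have /andP[l2 u2] := truncn_itv h2; have /andP[l3 u3] := truncn_itv h3.
move: (Num.truncn x0) (Num.truncn x1) (Num.truncn x2) (Num.truncn x3)
  l0 l1 l2 l3 u0 u1 u2 u3 => n0 n1 n2 n3 l0 l1 l2 l3 u0 u1 u2 u3.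
have snat : (n0 + n1 + n2 + n3)%:R = n0%:R + n1%:R + n2%:R + n3%:R :> R.
  by rewrite !natrD.
rewrite -natr1 in u0; rewrite -natr1 in u1; rewrite -natr1 in u2; rewrite -natr1 in u3.
have s5 : (n0 + n1 + n2 + n3 <= 5)%N by rewrite -(ler_nat R) snat; lra.
have s2 : (1 < n0 + n1 + n2 + n3)%N by rewrite -(ltr_nat R) snat; lra.
move: s5; rewrite leq_eqVlt => /orP[/eqP s5|s4]; last first.
  exists n0, n1, n2, n3; split.
    by rewrite /cell_index /= addn0 !addnA s2.
  rewrite -!natr1; split; first by split; lra.
  have p0 : 0 <= n0%:R :> R by []. have p1 : 0 <= n1%:R :> R by [].
  have p2 : 0 <= n2%:R :> R by []. have p3 : 0 <= n3%:R :> R by [].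
  by move=> hz; rewrite -(ltr_nat R) snat; case: hz => hz; lra.
(* Sum 5 leaves no fractional parts. Lowering one positive entry by 1 gives an index of sum 4 whose
   cell has the point at the upper end in that coordinate. *)
have e0 : x0 = n0%:R by move: snat; rewrite s5; lra.
have e1 : x1 = n1%:R by move: snat; rewrite s5; lra.
have e2 : x2 = n2%:R by move: snat; rewrite s5; lra.
have e3 : x3 = n3%:R by move: snat; rewrite s5; lra.
clear -s5 e0 e1 e2 e3.
case: n0 s5 e0 => [|n0] s5 e0; last first.
  have s4 : (n0 + n1 + n2 + n3 = 4)%N by move: s5; rewrite ?add0n !addSn => -[].
  exists n0, n1, n2, n3; split; first by rewrite /cell_index /= addn0 !addnA s4.
  by rewrite e0 e1 e2 e3 -!natr1 s4; split=> //; split; lra.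
case: n1 s5 e1 => [|n1] s5 e1; last first.
  have s4 : (0 + n1 + n2 + n3 = 4)%N by move: s5; rewrite ?add0n !addSn => -[].
  exists 0%N, n1, n2, n3; split; first by rewrite /cell_index /= addn0 !addnA s4.
  by rewrite e0 e1 e2 e3 -!natr1 s4; split=> //; split; lra.
case: n2 s5 e2 => [|n2] s5 e2; last first.
  have s4 : (0 + 0 + n2 + n3 = 4)%N by move: s5; rewrite ?add0n !addSn => -[].
  exists 0%N, 0%N, n2, n3; split; first by rewrite /cell_index /= addn0 !addnA s4.
  by rewrite e0 e1 e2 e3 -!natr1 s4; split=> //; split; lra.
exists 0%N, 0%N, 0%N, 4; move: s5; rewrite !add0n => s5.
rewrite e0 e1 e2 e3 s5; split=> //; split=> //; split; lra.
Qed.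

(** * Tilings and swaps by translations *)

Definition tiling {I : finType} (C : I -> set pt) (P : set pt) :=
  (forall i j, i != j -> interior (C i) `&` interior (C j) = set0) /\
  \bigcup_i C i = P.

(** The moved pieces fill [P] itself, not just a congruent copy, so swaps of the tiles of a tiling
    can be performed side by side. The closure accounts for boundary points on edges of pieces,
    which are only limits of points on internal cuts. *)
Definition swap_tiling (P : set pt) (I : finType) (C : I -> set pt) (t : I -> pt) :=
  [/\ forall i, polyhedron (C i), tiling C P,
      tiling (fun i => motion 1%:M (t i) @` C i) P &
      P `\` interior P `<=` closure
        (\bigcup_i motion 1%:M (t i) @` (boundary (C i) `&` interior P))].

Definition self_swap (P : set pt) := exists I C t, swap_tiling P I C t.

Lemma motion1E (t x : pt) : motion 1%:M t x = x + t.
Proof. by rewrite /motion mulmx1. Qed.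

(** * The cells of one tetrahedron in barycentric coordinates *)

Section Cells.
Variables (V : 'I_4 -> pt) (L : 'I_4 -> pt -> R).
Hypothesis VL : barycentric V L.

Lemma bary_continuous j : continuous (L j). Proof. by case: VL. Qed.

Lemma bary_sum p : \sum_j L j p = 1. Proof. by case: VL. Qed.

Lemma bary_comb p : p = \sum_j L j p *: V j. Proof. by case: VL. Qed.

Lemma bary_coord l j : \sum_k l k = 1 -> L j (\sum_k l k *: V k) = l j.
Proof. by case: VL => _ _ _ h /h. Qed.

Lemma bary_translate p w j : \sum_k w k = 0 ->
  L j (p + \sum_k w k *: V k) = L j p + w j.
Proof.
move=> w0; rewrite {1}[p]bary_comb -big_split /=.
under eq_bigr do rewrite -scalerDl.
by rewrite (bary_coord (fun k => L k p + w k))// big_split /= bary_sum w0 addr0.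
Qed.

Lemma bary_slope (i : 'I_4) (s : R) : exists w : pt, forall (p : pt) e,
  L i (p + e *: w) = L i p + e * s.
Proof.
(* The change [s] at [i] is balanced by [- s / 3] at the other three coordinates, so that the total
   is 0. *)
pose w (k : 'I_4) : R := s * ((k == i)%:R * (4 / 3) - 1 / 3).
have w0 : \sum_k w k = 0.
  rewrite -mulr_sumr big_split /= -mulr_suml sumr_const card_ord.
  rewrite (bigD1 i)//= big1 ?eqxx; last by move=> k /negbTE ->.
  by rewrite mulr1n; field.
exists (\sum_k w k *: V k) => p e.
rewrite scaler_sumr; under eq_bigr do rewrite scalerA.
rewrite bary_translate /w ?eqxx; last by rewrite -mulr_sumr w0 mulr0.
by rewrite mulr1n; field.
Qed.

Lemma interior_bary_gt (i : 'I_4) (a : R) (A : set pt) : (forall p, A p -> a <= L i p) ->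
  forall p, interior A p -> a < L i p.
Proof.
move=> Aa p Ap; have [w wE] := bary_slope i (-1).
have [e [e0 _ /Aa]] := nbhs_segment _ w _ Ap.
by rewrite wE; lra.
Qed.

Lemma interior_bary_lt (i : 'I_4) (a : R) (A : set pt) : (forall p, A p -> L i p <= a) ->
  forall p, interior A p -> L i p < a.
Proof.
move=> Aa p Ap; have [w wE] := bary_slope i 1.
have [e [e0 _ /Aa]] := nbhs_segment _ w _ Ap.
by rewrite wE; lra.
Qed.

Definition cell (b : seq nat) : set pt :=
  [set p | forall j : 'I_4, (nth 0%N b j)%:R <= 5 * L j p <= (nth 0%N b j).+1%:R].

Lemma interior_cell b (p : pt) (j : 'I_4) : interior (cell b) p ->
  (nth 0%N b j)%:R < 5 * L j p < (nth 0%N b j).+1%:R.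
Proof.
move=> bp; apply/andP; split.
  rewrite mulrC -ltr_pdivrMr//; move: bp; apply: interior_bary_gt => q /(_ j).
  by rewrite ler_pdivrMr// mulrC => /andP[].
rewrite mulrC -ltr_pdivlMr//; move: bp; apply: interior_bary_lt => q /(_ j).
by rewrite ler_pdivlMr// mulrC => /andP[].
Qed.

(** In each coordinate a common interior point lies in two open unit intervals with integer ends,
    which forces these to agree. *)
Lemma interior_cell_disjoint b c : size b = 4 -> size c = 4 -> b != c ->
  interior (cell b) `&` interior (cell c) = set0.
Proof.
move=> b4 c4 /eqP bc; rewrite -subset0 => p [/interior_cell bp /interior_cell cp].
apply/bc/(@eq_from_nth _ 0%N); first by rewrite b4.
move=> i; rewrite b4 => i4; apply/eqP; rewrite eqn_leq.
have /andP[b1 b2] := bp (Ordinal i4); have /andP[c1 c2] := cp (Ordinal i4).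
by apply/andP; split; rewrite -ltnS -(ltr_nat R); [apply: lt_trans b1 c2|apply: lt_trans c1 b2].
Qed.

Lemma sum_nth4 (b : seq nat) : size b = 4 ->
  \sum_(j < 4) (nth 0%N b j)%:R = (sumn b)%:R :> R.
Proof.
case: b => [|a [|b [|c [|d []]]]] //= _.
by rewrite !big_ord_recl big_ord0 /= !natrD.
Qed.

(** Equal sums make the coordinate differences add up to 0, so they describe a translation
    vector. *)
Lemma motion_cell b c : size b = 4 -> size c = 4 -> sumn b = sumn c ->
  motion 1%:M (\sum_(j < 4) (((nth 0%N c j)%:R - (nth 0%N b j)%:R) / 5) *: V j) @` cell b
  = cell c.
Proof.
move=> b4 c4 bc.
have w0 : \sum_(j < 4) ((nth 0%N c j)%:R - (nth 0%N b j)%:R) / 5 = 0 :> R.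
  by rewrite -mulr_suml sumrB !sum_nth4// bc subrr mul0r.
apply/seteqP; split=> [_ [p bp <-] j|p cp].
  rewrite motion1E bary_translate//; have := bp j.
  by rewrite /= -(natr1 (nth 0%N b j)) -(natr1 (nth 0%N c j)); lra.
exists (p + \sum_(j < 4) - (((nth 0%N c j)%:R - (nth 0%N b j)%:R) / 5) *: V j).
  move=> j; rewrite bary_translate ?sumrN ?w0 ?oppr0//.
  have := cp j.
  by rewrite /= -(natr1 (nth 0%N b j)) -(natr1 (nth 0%N c j)); lra.
rewrite motion1E -addrA -big_split /= big1 ?addr0// => j _.
by rewrite -scalerDl addNr scale0r.
Qed.

Lemma polyhedron_cell b :
  nondeg_tetra (V ord0) (V (lift ord0 ord0)) (V (lift ord0 (lift ord0 ord0)))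
    (V (lift ord0 (lift ord0 (lift ord0 ord0)))) ->
  cell_index b -> polyhedron (cell b).
Proof.
set V0 := V _; set V1 := V _; set V2 := V _; set V3 := V _ => nd.
have {}nd : nondeg_tetra (5^-1 *: V0) (5^-1 *: V1) (5^-1 *: V2) (5^-1 *: V3).
  apply/nondeg_tetraE; move/nondeg_tetraE: nd; apply: contra_neq => h.
  rewrite -[LHS](mulKf (_ : 5^-1 ^+ 3 != 0)) ?expf_neq0 ?invr_eq0//.
  rewrite -[RHS](mulr0 (5^-1 ^+ 3)^-1); congr (_ * _).
  by rewrite -h /det3 !mxE; ring.
case: b => [|b0 [|b1 [|b2 [|b3 []]]]] // /andP[_ /=].
rewrite addn0 !addnA => hb.
(* The excesses [5 * L j p - b_j] lie in [0, 1] and sum to 5 minus the sum of the index, that is to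
   3, 2 or 1. *)
suff -> : cell [:: b0; b1; b2; b3] = hypersimplex (5 - (b0 + b1 + b2 + b3)%:R)
    (b0%:R *: (5^-1 *: V0) + b1%:R *: (5^-1 *: V1)
      + b2%:R *: (5^-1 *: V2) + b3%:R *: (5^-1 *: V3))
    (5^-1 *: V0) (5^-1 *: V1) (5^-1 *: V2) (5^-1 *: V3).
  have [->|->|->] : [\/ b0 + b1 + b2 + b3 = 2, b0 + b1 + b2 + b3 = 3 |
                        b0 + b1 + b2 + b3 = 4]%N.
  - move: (b0 + b1 + b2 + b3)%N hb => -[|[|[|[|[|n]]]]] // _.
    + by constructor 1.
    + by constructor 2.
    + by constructor 3.
  - by rewrite (_ : 5 - 2%:R = 3); [exact: polyhedron_hypersimplex3|ring].
  - by rewrite (_ : 5 - 3%:R = 2); [exact: polyhedron_hypersimplex2|ring].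
  - by rewrite (_ : 5 - 4%:R = 1); [exact: polyhedron_hypersimplex1|ring].
apply/seteqP; split=> p.
  move=> hp; have := bary_sum p; have := bary_comb p; rewrite !big_ord_recl !big_ord0.
  have /= := hp ord0; have /= := hp (lift ord0 ord0).
  have /= := hp (lift ord0 (lift ord0 ord0)).
  have /= := hp (lift ord0 (lift ord0 (lift ord0 ord0))).
  move: (L ord0 p) (L _ p) (L _ p) (L _ p) => l0 l1 l2 l3.
  rewrite -!natr1 => h3 h2 h1 h0 -> hs.
  exists (5 * l0 - b0%:R), (5 * l1 - b1%:R), (5 * l2 - b2%:R), (5 * l3 - b3%:R).
  split; first by split; lra.
  split; first by rewrite !natrD; lra.
  by apply/rowP => i; rewrite !mxE; field.
move=> [f0 [f1 [f2 [f3 [[h0 h1 h2 h3] [hs ->]]]]]].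
pose l (k : 'I_4) : R := [:: (b0%:R + f0) / 5; (b1%:R + f1) / 5;
  (b2%:R + f2) / 5; (b3%:R + f3) / 5]`_k.
set q := (X in cell _ X).
have -> : q = \sum_k l k *: V k.
  rewrite !big_ord_recl big_ord0 /l /q /=.
  by apply/rowP => i; rewrite !mxE; field.
move=> j; rewrite bary_coord; last first.
  by rewrite !big_ord_recl big_ord0 /l /=; move: hs; rewrite !natrD; lra.
by case: j => -[|[|[|[|//]]]] /= i; rewrite /l /= -?(natr1 b0) -?(natr1 b1) -?(natr1 b2) -?(natr1 b3); lra.
Qed.

Definition tetra : set pt := [set p | forall j, 0 <= L j p].

Lemma bary_point (f : 'I_4 -> R) : \sum_j f j = 1 -> exists p, forall j, L j p = f j.
Proof. by move=> f1; exists (\sum_k f k *: V k) => j; rewrite bary_coord. Qed.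

Lemma bary_segment (p m : pt) (e : R) j :
  L j (p + e *: (m - p)) = (1 - e) * L j p + e * L j m.
Proof.
have -> : p + e *: (m - p) = \sum_k ((1 - e) * L k p + e * L k m) *: V k.
  under eq_bigr do rewrite scalerDl -!scalerA.
  rewrite big_split /= -!scaler_sumr -!bary_comb.
  by apply/rowP => i; rewrite !mxE; ring.
by rewrite bary_coord// big_split /= -!mulr_sumr !bary_sum; ring.
Qed.

Lemma interior_tetra (p : pt) : (forall j, 0 < L j p) -> interior tetra p.
Proof.
move=> p0; rewrite /interior /=.
have : \forall q \near p, forall j, 0 < L j q.
  apply: (@filter_forall pt 'I_4 (fun j q => 0 < L j q) (nbhs p)) => j.
  exact: (bary_continuous j p _ (lt_nbhsr (p0 j))).
by apply: filterS => q q0 j; exact/ltW.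
Qed.

Lemma closed_tetra : closed tetra.
Proof.
move=> p clp j; rewrite leNgt; apply/negP => pj.
have /clp[q [q0]] : nbhs p [set q | L j q < 0].
  exact: (bary_continuous j p _ (lt_nbhsl pj)).
by rewrite /= ltNge q0.
Qed.

Lemma cell_cover (p : pt) : tetra p -> exists b, [/\ cell_index b, cell b p &
  forall j, L j p = 0 -> (3 <= sumn b)%N].
Proof.
move=> tp.
have p5 j : 0 <= 5 * L j p by rewrite mulr_ge0.
have s5 : 5 * L ord0 p + 5 * L (lift ord0 ord0) p + 5 * L (lift ord0 (lift ord0 ord0)) p
    + 5 * L (lift ord0 (lift ord0 (lift ord0 ord0))) p = 5.
  by have := bary_sum p; rewrite !big_ord_recl big_ord0; lra.
have [b0 [b1 [b2 [b3 [bi [[h0 h1 h2 h3] hz]]]]]] :=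
  cell_index_cover _ _ _ _ (p5 _) (p5 _) (p5 _) (p5 _) s5.
exists [:: b0; b1; b2; b3]; split=> //.
- case; case=> [|[|[|[|//]]]] /= i; [move: h0|move: h1|move: h2|move: h3];
    by congr (is_true (_ <= 5 * L _ p <= _)); exact/val_inj.
- move=> j j0; rewrite /= addn0 !addnA; apply: hz.
  case: j j0 => -[|[|[|[|//]]]] i j0.
  + by constructor 1; rewrite (_ : ord0 = Ordinal i) ?j0 ?mulr0//; exact/val_inj.
  + by constructor 2; rewrite (_ : lift _ _ = Ordinal i) ?j0 ?mulr0//; exact/val_inj.
  + by constructor 3; rewrite (_ : lift _ _ = Ordinal i) ?j0 ?mulr0//; exact/val_inj.
  + by constructor 4; rewrite (_ : lift _ _ = Ordinal i) ?j0 ?mulr0//; exact/val_inj.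
Qed.

Lemma cell_sub_tetra b : cell b `<=` tetra.
Proof.
move=> p bp j; have /andP[h _] := bp j.
by rewrite -(pmulr_rge0 _ (_ : 0 < 5 :> R))//; apply: le_trans h.
Qed.

Lemma cells_tiling (I : finType) (f : I -> seq nat) : injective f ->
  (forall i, cell_index (f i)) -> (forall b, cell_index b -> exists i, f i = b) ->
  tiling (fun i => cell (f i)) tetra.
Proof.
move=> fI fi fs; split.
  move=> i j ij; apply: interior_cell_disjoint.
  - by have /andP[/eqP] := fi i.
  - by have /andP[/eqP] := fi j.
  - by apply: contra ij => /eqP/fI ->.
apply/seteqP; split=> [p [i _]|p /cell_cover[b [/fs[i <-] bp _]]].
  exact: cell_sub_tetra.
by exists i.
Qed.

Lemma facet_point b (i : 'I_4) : cell_index b -> (3 <= sumn b)%N ->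
  nth 0%N b i = 0%N -> exists m : pt, L i m = 0 /\ forall j, j != i ->
    (nth 0%N b j)%:R < 5 * L j m < (nth 0%N b j).+1%:R.
Proof.
move=> /andP[/eqP b4 /andP[_ hb4]] hb3 bi.
(* The excess is shared equally among the three coordinates other than [i]; for sums 3 and 4 each
   share is 2/3 or 1/3, strictly between 0 and 1, so [m] is in the relative interior of the
   facet. *)
pose t : R := (5 - (sumn b)%:R) / 3.
have t0 : 0 < t.
  have : (sumn b)%:R <= 4 :> R by rewrite (ler_nat R _ 4).
  by rewrite /t; lra.
have t1 : t < 1.
  have : 3 <= (sumn b)%:R :> R by rewrite (ler_nat R 3).
  by rewrite /t; lra.
pose f (j : 'I_4) : R := ((nth 0%N b j)%:R + t * (j != i)%:R) / 5.
have f1 : \sum_j f j = 1.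
  rewrite -mulr_suml big_split /= sum_nth4// -mulr_sumr.
  rewrite (bigD1 i)//= eqxx (eq_bigr (fun=> 1)); last by move=> j ->.
  rewrite sumr_const (_ : #|_| = 3%N); last first.
    by have := cardC1 i; rewrite card_ord; apply: etrans; apply: eq_card.
  by rewrite mulr0n /t; field.
have [m hm] := bary_point _ f1; exists m; split.
  by rewrite hm /f bi eqxx !mulr0n mulr0 addr0 mul0r.
move=> j ji; rewrite hm /f ji mulr1n -(natr1 (nth 0%N b j)); lra.
Qed.

Lemma tetra_self_swap :
  nondeg_tetra (V ord0) (V (lift ord0 ord0)) (V (lift ord0 (lift ord0 ord0)))
    (V (lift ord0 (lift ord0 (lift ord0 ord0)))) ->
  self_swap tetra.
Proof.
move=> nd.
pose mv (k : 'I_(size moves)) := nth ([::], [::]) moves k.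
have mv_in k : mv k \in moves by rewrite mem_nth.
have mv1 k : cell_index (mv k).1 by rewrite -mem_moves1 map_f.
have mv2 k : cell_index (mv k).2 by rewrite -mem_moves2 map_f.
have ex (g : seq nat * seq nat -> seq nat) b : b \in map g moves -> exists k, g (mv k) = b.
  move=> /mapP[c cm ->]; rewrite -index_mem in cm.
  by exists (Ordinal cm); rewrite /mv /= nth_index// -index_mem.
have injg (g : seq nat * seq nat -> seq nat) : uniq (map g moves) ->
    injective (fun k => g (mv k)).
  move=> um k l kl; apply/val_inj/eqP => /=.
  rewrite -(nth_uniq [::] _ _ um) ?size_map//.
  by rewrite !(nth_map ([::], [::]))//; apply/eqP.
have [u1 u2] := moves_uniq.
pose t k : pt := \sum_(j < 4)
  (((nth 0%N (mv k).2 j)%:R - (nth 0%N (mv k).1 j)%:R) / 5) *: V j.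
have tE k : motion 1%:M (t k) @` cell (mv k).1 = cell (mv k).2.
  have /andP[/eqP m1 _] := mv1 k; have /andP[/eqP m2 _] := mv2 k.
  by rewrite motion_cell//; exact: moves_sumn.
exists 'I_(size moves), (fun k => cell (mv k).1), t; split.
- by move=> k; exact: polyhedron_cell.
- apply: cells_tiling; [exact: injg u1|by []|].
  by move=> b; rewrite -mem_moves1; exact: ex.
- under [X in tiling X]eq_fun do rewrite tE.
  apply: cells_tiling; [exact: injg u2|by []|].
  by move=> b; rewrite -mem_moves2; exact: ex.
(* Approximate [p] by a point [p'] in the relative interior of a facet of a moved
   cell: its preimage [q] lies on an internal cut because the facet of the
   original cell parallel to it is not exposed. *)
move=> p [tp ntp].
have [i pi0] : exists i, L i p = 0.
  apply: contrapT => h; apply: ntp; apply: interior_tetra => j.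
  rewrite lt_neqAle tp andbT eq_sym; apply/eqP => j0.
  by apply: h; exists j.
have [b [bi bp /(_ _ pi0) b3]] := cell_cover _ tp.
have bi0 : nth 0%N b i = 0%N.
  have /andP[+ _] := bp i; rewrite pi0 mulr0.
  by rewrite (ler_nat R _ 0) leqn0 => /eqP.
have [k kb] : exists k, (mv k).2 = b by apply: ex; rewrite -mem_moves2 in bi.
have [m [m0 mj]] := facet_point _ _ bi b3 bi0.
move=> N /(nbhs_segment _ (m - p))[e [e0 e1 Ne]].
exists (p + e *: (m - p)); split=> //.
set p' := p + _ in Ne *.
have p'i : L i p' = 0 by rewrite bary_segment pi0 m0; ring.
(* With [0 < e <= 1], [p'] is a convex combination giving positive weight to [m], so the strict
   inequalities at [m] survive. *)
have p'j j : j != i -> (nth 0%N b j)%:R < 5 * L j p' < (nth 0%N b j).+1%:R.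
  move=> /mj; have := bp j; rewrite bary_segment -(natr1 (nth 0%N b j)); nra.
have bp' : cell b p'.
  move=> j; have [->|/p'j/andP[h1 h2]] := eqVneq j i.
    by rewrite p'i bi0 mulr0 lexx ler0n.
  by rewrite !ltW.
move: (bp'); rewrite -kb -tE => -[q cq qp'].
have qE j : 5 * L j q = 5 * L j p' - (nth 0%N b j)%:R + (nth 0%N (mv k).1 j)%:R.
  rewrite -qp' motion1E bary_translate ?kb; first by field.
  have /andP[/eqP m1 _] := mv1 k; have /andP[/eqP m2 _] := mv2 k.
  by rewrite -mulr_suml sumrB !sum_nth4 -?kb// moves_sumn// subrr mul0r.
have exposed : (0 < nth 0%N (mv k).1 i)%N.
  by apply: moves_exposed; rewrite ?kb.
have qi : 5 * L i q = (nth 0%N (mv k).1 i)%:R by rewrite qE p'i bi0; ring.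
exists k => //; exists q => //; split; first split.
(* [q] is not interior to its cell, because its coordinate [i] attains the lower bound; it is
   interior to the tetrahedron, because that bound is positive and the other coordinates exceed
   theirs strictly. *)
- exact: subset_closure.
- by move=> qint; have := interior_cell _ _ i qint; rewrite qi ltxx.
- apply: interior_tetra => j; rewrite -(pmulr_rgt0 _ (_ : 0 < 5 :> R))//.
  have [->|/p'j/andP[h1 h2]] := eqVneq j i; first by rewrite qi ltr0n.
  rewrite qE; have := ler0n R (nth 0%N (mv k).1 j); lra.
Qed.

End Cells.

(** * Transfer to convex hulls, and closedness of polyhedra *)

Lemma conv_tetra (a b c d : pt) : nondeg_tetra a b c d ->
  exists2 L, barycentric (fun j => [:: a; b; c; d]`_j) L &
             Defs.conv [:: a; b; c; d] = tetra L.
Proof.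
move=> /barycentric_exists[L VL]; exists L => //.
apply/seteqP; split=> [_ [l [l0 [l1 ->]]] j|p p0].
  by case: VL => _ _ _ ->.
by exists (fun j => L j p); case: VL => _ L1 LV _; split.
Qed.

Lemma conv_self_swap (a b c d : pt) :
  nondeg_tetra a b c d -> self_swap (Defs.conv [:: a; b; c; d]).
Proof.
by move=> nd; have [L VL ->] := conv_tetra _ _ _ _ nd; exact: (tetra_self_swap _ _ VL nd).
Qed.

Lemma closed_conv (a b c d : pt) :
  nondeg_tetra a b c d -> closed (Defs.conv [:: a; b; c; d]).
Proof. by move=> /conv_tetra[L VL ->]; exact: (closed_tetra _ _ VL). Qed.

Lemma polyhedron_closed (P : set pt) : polyhedron P -> closed P.
Proof.
move=> [n [a [b [c [d [_ [nd ->]]]]]]]; apply: closed_bigcup => [|i _].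
  exact: finite_finset.
exact: closed_conv.
Qed.

(** * Gluing swaps of tiles, and passage to inside-out dissections *)

Lemma tiling_sigma (I : finType) (J : I -> finType) (C : I -> set pt)
    (D : forall i, J i -> set pt) (P : set pt) :
  tiling C P -> (forall i, tiling (D i) (C i)) ->
  tiling (fun u : {i : I & J i} => D (tag u) (tagged u)) P.
Proof.
move=> [Cd CP] DC; split.
  move=> [i a] [j b] /= ab; have [ij|ij] := eqVneq i j.
    case: j / ij b ab => b ab; apply: (DC i).1.
    by apply: contra_neq ab => ->.
  rewrite -subset0 -(Cd _ _ ij); apply: setISS; apply: interiorS.
    by rewrite -(DC i).2; exact: bigcup_sup.
  by rewrite -(DC j).2; exact: bigcup_sup.
rewrite -CP; apply/seteqP; split=> [p [[i a] _ /= Dp]|p [i _]].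
  by exists i => //; rewrite -(DC i).2; exists a.
by rewrite -(DC i).2 => -[a _ Dp]; exists (Tagged J a).
Qed.

(** A boundary point of [P] lies in some tile but not in its interior, which is part of the interior
    of [P]. So the swap of that tile approximates it by cuts interior to the tile, hence interior to
    [P]. *)
Lemma self_swap_tiling (I : finType) (C : I -> set pt) (P : set pt) :
  tiling C P -> (forall i, self_swap (C i)) -> self_swap P.
Proof.
move=> CP CS.
have [J /fin_all_exists[D /fin_all_exists[t Dt]]] := fin_all_exists CS.
exists {i : I & J i}, (fun u => D (tag u) (tagged u)), (fun u => t (tag u) (tagged u)).
split.
- by move=> [i a]; have [+ _ _ _] := Dt i; exact.
- by apply: (tiling_sigma _ J C D) => // i; have [] := Dt i.
- apply: (tiling_sigma _ J C (fun i a => motion 1%:M (t i a) @` D i a)) => // i.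
  by have [] := Dt i.
have CsubP i : C i `<=` P by rewrite -CP.2; exact: bigcup_sup.
move=> p [Pp nPp]; move: Pp; rewrite -{1}CP.2 => -[i _ Cp].
have [_ _ _ /(_ p)] := Dt i.
have ncp : ~ interior (C i) p by move: nPp; apply: contra_not; exact: interiorS.
move=> /(_ (conj Cp ncp)); apply: closure_subset => _ [a _ [q [bq iq] <-]].
exists (Tagged J a) => //; exists q => //; split=> //.
exact: interiorS iq.
Qed.

Lemma self_swap_dissectable (P : set pt) :
  closed P -> self_swap P -> inside_out_dissectable P.
Proof.
move=> cP [I [C [t [Cpoly CP CP' bP]]]].
have reindex (D : I -> set pt) (Q : set pt) : tiling D Q ->
    decomposition (fun i : 'I_#|I| => D (enum_val i)) Q.
  move=> [Dd DQ]; split.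
    by move=> i j ij; apply: Dd; rewrite (inj_eq enum_val_inj).
  rewrite -DQ; apply/seteqP; split=> [p [i _ Dp]|p [i _ Dp]].
    by exists (enum_val i).
  by exists (enum_rank i) => //; rewrite enum_rankK.
exists #|I|, (fun i => C (enum_val i)), (fun=> 1%:M), (fun i => t (enum_val i)), P.
split; first by move=> i; exact: Cpoly.
split; first exact: reindex.
split.
  by move=> i; split; [rewrite /orthogonal_mx trmx1 mulmx1|exact: det1].
split; first exact: reindex CP'.
split.
  exists 1%:M, 0; split; first by rewrite /orthogonal_mx trmx1 mulmx1.
  rewrite (_ : motion _ _ = id) ?image_id//.
  by apply/funext => p; rewrite motion1E addr0.
rewrite /boundary -(proj1 (closure_id P) cP).
apply: (subset_trans bP); apply: closure_subset => p [i _ h].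
by exists (enum_rank i) => //; rewrite enum_rankK.
Qed.

(** * Regular tetrahedra and octahedra *)

Lemma regular_tetrahedron_self_swap (T : set pt) :
  regular_tetrahedron T -> self_swap T.
Proof.
move=> [a [b [c [d [s [s0 [ab [ac [ad [bc [bd [cd ->]]]]]]]]]]]].
apply/conv_self_swap/nondeg_tetraE; rewrite -sqrf_eq0 det3_gram.
have self (x y : pt) : sqdist x y = s -> dot (y - x) (y - x) = s.
  by move=> <-; rewrite /sqdist !dotE !mxE; ring.
(* Law of cosines in an equilateral triangle; the Gram determinant then equals [s ^+ 3 / 2]. *)
have cross (x y z : pt) : sqdist x y = s -> sqdist x z = s -> sqdist y z = s ->
    dot (y - x) (z - x) = s / 2.
  move=> xy xz yz; have : dot (y - x) (z - x) =
      (sqdist x y + sqdist x z - sqdist y z) / 2.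
    by rewrite /sqdist !dotE !mxE; field.
  by rewrite xy xz yz => ->; field.
rewrite !(self, cross)//.
have -> : s * (s * s - (s / 2) ^+ 2) - s / 2 * (s / 2 * s - s / 2 * (s / 2)) +
    s / 2 * (s / 2 * (s / 2) - s * (s / 2)) = s ^+ 3 / 2 by field.
by rewrite gt_eqF// divr_gt0// exprn_gt0.
Qed.

Lemma interior_dot_gt0 (c u : pt) (A : set pt) : 0 < dot u u ->
  (forall p, A p -> 0 <= dot (p - c) u) ->
  forall p, interior A p -> 0 < dot (p - c) u.
Proof.
move=> u0 Au p Ap; have [e [e0 _ /Au]] := nbhs_segment _ (- u) _ Ap.
have -> : dot (p + e *: (- u) - c) u = dot (p - c) u - e * dot u u.
  by rewrite !dotE !mxE; ring.
by rewrite subr_ge0; apply: lt_le_trans; rewrite mulr_gt0.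
Qed.

Lemma regular_octahedron_self_swap (O : set pt) :
  regular_octahedron O -> self_swap O.
Proof.
move=> [c [u [v [w [u0 [vu [wu [uv [uw [vw ->]]]]]]]]]].
pose sg (s : bool) (x : pt) : pt := if s then x else - x.
(* The four tetrahedra share the diagonal from [c + w] to [c - w]; the two booleans are the signs of
   the coordinates along [u] and [v]. *)
pose T (st : bool * bool) :=
  Defs.conv [:: c + w; c - w; c + sg st.1 u; c + sg st.2 v].
have dot_sg s x y : dot x (sg s y) = (if s then dot x y else - dot x y).
  by case: s => //; rewrite !dotE !mxE; ring.
have dC (x y : pt) : dot x y = dot y x by rewrite !dotE; ring.
have sgN s (x y : pt) : dot (sg s x) (sg s y) = dot x y.
  by case: s => //; rewrite !dotE !mxE; ring.
have wu0 s : dot w (sg s u) = 0 by rewrite dot_sg dC uw oppr0 if_same.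
have wv0 s : dot w (sg s v) = 0 by rewrite dot_sg dC vw oppr0 if_same.
have uv0 s t : dot (sg s u) (sg t v) = 0.
  by rewrite dot_sg dC dot_sg dC uv oppr0 !if_same oppr0 if_same.
apply: (@self_swap_tiling _ T); last first.
  move=> [s t]; apply/conv_self_swap/nondeg_tetraE.
  have -> : det3 (c - w - (c + w)) (c + sg s u - (c + w)) (c + sg t v - (c + w))
      = - 2 * det3 w (sg s u) (sg t v).
    by rewrite /det3 !mxE; ring.
  rewrite mulf_neq0 ?oppr_eq0// -sqrf_eq0 det3_gram.
  rewrite !sgN wu0 wv0 uv0 vu wu !mul0r expr0n /= !(subr0, addr0).
  by rewrite gt_eqF// !mulr_gt0.
split.
  (* Two distinct tetrahedra differ in a sign, so the plane through [c] orthogonal to [u] or to [v]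
     separates their interiors. *)
  have side (s : bool) (x : pt) (A : set pt) p : 0 < dot x x ->
      (forall q, A q -> 0 <= dot (q - c) (sg s x)) -> interior A p ->
      0 < dot (p - c) (sg s x).
    move=> x0 h Ap; apply: interior_dot_gt0 Ap => //.
    by case: s {h} => //; move: x0; rewrite !dotE !mxE; lra.
  move=> [s t] [s' t'] st; rewrite -subset0 => p [pst pst'].
  have Tu s1 t1 q : T (s1, t1) q -> 0 <= dot (q - c) (sg s1 u).
    move=> /conv4P[l0 [l1 [l2 [l3 [[h0 h1 h2 h3] [hs ->]]]]]].
    rewrite (_ : dot _ _ = (l0 - l1) * dot w (sg s1 u) + l2 * dot (sg s1 u) (sg s1 u)
        + l3 * dot (sg s1 u) (sg t1 v)).
      by rewrite wu0 sgN uv0 !mulr0 add0r addr0 mulr_ge0// ltW.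
    have -> : l0 = 1 - l1 - l2 - l3 by lra.
    by rewrite !dotE !mxE; ring.
  have Tv s1 t1 q : T (s1, t1) q -> 0 <= dot (q - c) (sg t1 v).
    move=> /conv4P[l0 [l1 [l2 [l3 [[h0 h1 h2 h3] [hs ->]]]]]].
    rewrite (_ : dot _ _ = (l0 - l1) * dot w (sg t1 v) + l2 * dot (sg s1 u) (sg t1 v)
        + l3 * dot (sg t1 v) (sg t1 v)).
      by rewrite wv0 sgN uv0 !mulr0 !add0r vu mulr_ge0// ltW.
    have -> : l0 = 1 - l1 - l2 - l3 by lra.
    by rewrite !dotE !mxE; ring.
  have su := side _ _ _ _ u0 (Tu s t) pst.
  have su' := side _ _ _ _ u0 (Tu s' t') pst'.
  have v0 : 0 < dot v v by rewrite vu.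
  have tv := side _ _ _ _ v0 (Tv s t) pst.
  have tv' := side _ _ _ _ v0 (Tv s' t') pst'.
  rewrite !dot_sg in su su' tv tv'.
  by move: s s' t t' st su su' tv tv' {pst pst'} => [] [] [] [] //= _; lra.
apply/seteqP; split=> p.
  move=> [[s t] _ /conv4P[l0 [l1 [l2 [l3 [[h0 h1 h2 h3] [hs ->]]]]]]].
  apply/conv6P.
  exists (if s then l2 else 0), (if s then 0 else l2), (if t then l3 else 0),
    (if t then 0 else l3), l0, l1.
  split; first by split; case: (s); case: (t).
  split; first by split; case: (s); case: (t).
  split; first by case: (s); case: (t); lra.
  by case: (s); case: (t); apply/rowP => i; rewrite !mxE; ring.
move=> /conv6P[l0 [l1 [l2 [l3 [l4 [l5 [[h0 h1 h2] [[h3 h4 h5] [hs ->]]]]]]]]].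
(* Equal weights on opposite vertices contribute a multiple of [c], so the common part of each pair
   can be shifted to [c + w] and [c - w]; what remains sits on one vertex of each pair. *)
pose m := Num.min l0 l1 + Num.min l2 l3.
exists (l1 <= l0, l3 <= l2) => //; apply/conv4P; rewrite /sg /=.
exists (l4 + m), (l5 + m), `|l0 - l1|, `|l2 - l3|; rewrite /m.
have [h01|h01] := lerP l1 l0; have [h23|h23] := lerP l3 l2.
all: split; first by split; lra.
all: split; first by lra.
all: have -> : l4 = 1 - l0 - l1 - l2 - l3 - l5 by lra.
all: by apply/rowP => i; rewrite !mxE; ring.
Qed.

End Dissection.

Theorem theorem1 (R : realType) (P : set 'rV[R]_3) :
  polyhedron P ->
  (exists (k : nat) (Pc : 'I_k -> set 'rV[R]_3),
      (forall i, regular_tetrahedron (Pc i) \/ regular_octahedron (Pc i)) /\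
      decomposition Pc P) ->
  inside_out_dissectable P.
Proof.
move=> /polyhedron_closed cP [k [C [Creg CP]]].
apply: self_swap_dissectable => //; apply: (self_swap_tiling _ C) => // i.
case: (Creg i); first exact: regular_tetrahedron_self_swap.
exact: regular_octahedron_self_swap.
Qed.
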